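(* If $G$ is a connected bipartite graph, then $\chi'_c(G)=\chi'(G)$.
   Context: All graphs are finite and simple. The chromatic index $\chi'(G)$ is the minimum number of colours in a proper edge colouring of $G$. An ordering $e_1,\dots,e_m$ of the edges of $G$ is connected if for every $i\ge 2$ the edge $e_i$ shares an endpoint with some $e_j$, $j<i$. The greedy edge colouring following an ordering $e_1,\dots,e_m$ assigns, for $i=1,\dots,m$, to $e_i$ the smallest positive integer not already assigned to an edge $e_j$ ($j<i$) sharing an endpoint with $e_i$. The connected greedy chromatic index $\chi'_c(G)$ (defined for connected $G$) is the minimum, over all connected orderings of $E(G)$, of the number of colours used by the greedy edge colouring following that ordering. *)

(* Defs.v *)
From HB Require Import structures.
From mathcomp Require Import all_boot.

Set Implicit Arguments.
Unset Strict Implicit.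
Unset Printing Implicit Defensive.

Record sgraph := SGraph {
  vertex :> finType;
  adj : rel vertex;
  adj_sym : symmetric adj;
  adj_irr : irreflexive adj }.

Definition connected_graph (G : sgraph) : Prop :=
  forall x y : G, connect (@adj G) x y.

Definition bipartite (G : sgraph) : Prop :=
  exists A : {set G}, forall x y : G, adj x y -> (x \in A) != (y \in A).

Definition edges (G : sgraph) : {set {set G}} :=
  [set [set x; y] | x in G, y in G & adj x y].

Definition edge (G : sgraph) : finType := {a : {set G} | a \in edges G}.

(* Every edge shares an endpoint with itself, so distinctness has to be
   required separately where it matters. *)
Definition share_endpoint (G : sgraph) (a b : edge G) : bool :=
  [exists x : G, (x \in val a) && (x \in val b)].

Definition proper_edge_coloring (G : sgraph) (C : eqType) (c : edge G -> C) :
    bool :=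
  [forall a, forall b, (a != b) && share_endpoint a b ==> (c a != c b)].

Definition edge_colorable (G : sgraph) (k : nat) : bool :=
  [exists c : {ffun edge G -> 'I_k}, proper_edge_coloring c].

Lemma ex_edge_colorable (G : sgraph) : exists k, edge_colorable G k.
Proof.
exists #|edge G|; apply/existsP; exists [ffun a => enum_rank a].
apply/forallP=> a; apply/forallP=> b; apply/implyP=> /andP[ab _].
by rewrite !ffunE (inj_eq enum_rank_inj).
Qed.

Definition chromatic_index (G : sgraph) : nat := ex_minn (ex_edge_colorable G).

Lemma ex_fresh_color (s : seq nat) : exists n, (0 < n) && (n \notin s).
Proof.
have le_sum x : x \in s -> x <= sumn s.
  elim: s => //= y s IHs; rewrite inE => /orP[/eqP->|/IHs le_x].
    exact: leq_addr.
  exact: leq_trans le_x (leq_addl _ _).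
exists (sumn s).+1; rewrite ltn0Sn /=.
by apply/negP=> /le_sum; rewrite ltnn.
Qed.

Definition fresh_color (s : seq nat) : nat := ex_minn (ex_fresh_color s).

Definition greedy_step (G : sgraph) (c : seq (edge G * nat)) (a : edge G) :
    seq (edge G * nat) :=
  rcons c (a, fresh_color [seq p.2 | p <- c & share_endpoint a p.1]).

(* The list of pairs (e_i, colour of e_i), in the order of s. *)
Definition greedy_coloring (G : sgraph) (s : seq (edge G)) :
    seq (edge G * nat) :=
  foldl (@greedy_step G) [::] s.

Definition greedy_num_colors (G : sgraph) (s : seq (edge G)) : nat :=
  size (undup [seq p.2 | p <- greedy_coloring s]).

Definition edge_ordering (G : sgraph) (s : seq (edge G)) : bool :=
  perm_eq s (enum (edge G)).

Definition connected_seq (G : sgraph) (n : nat) (s : n.-tuple (edge G)) :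
    bool :=
  [forall i : 'I_n, (0 < i) ==>
    [exists j : 'I_n, (j < i) && share_endpoint (tnth s i) (tnth s j)]].

Definition connected_greedy_colorable (G : sgraph) (k : nat) : bool :=
  [exists s : #|edge G|.-tuple (edge G),
    [&& edge_ordering s, connected_seq s & greedy_num_colors s == k]].

Lemma edge_vertex (G : sgraph) (a : edge G) : exists x, x \in val a.
Proof.
by case: a => a /= /imset2P[x y _ _ ->]; exists x; rewrite !inE eqxx.
Qed.

Lemma ex_next_edge (G : sgraph) (connG : connected_graph G)
    (s : seq (edge G)) (b c : edge G) :
  b \notin s -> c \in s ->
  exists a d, [/\ a \notin s, d \in s & share_endpoint a d].
Proof.
move=> bs cs; have [x xc] := edge_vertex c; have [y yb] := edge_vertex b.
pose S := [pred v : G | has (fun d : edge G => v \in val d) s].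
have xS : x \in S by apply/hasP; exists c.
have [/hasP[d ds yd]|yS] := boolP (y \in S).
  by exists b, d; split=> //; apply/existsP; exists y; rewrite yb yd.
have [/existsP[u /existsP[v /and3P[uS vS uv]]]|noexit] :=
  boolP [exists u, exists v, [&& u \in S, v \notin S & adj u v]].
  have uvE : [set u; v] \in edges G.
    by apply/imset2P; exists u v; rewrite ?inE.
  have /hasP[d ds ud] := uS.
  pose a : edge G := Sub [set u; v] uvE.
  exists a, d; split=> //.
    apply: contra vS => a_s; apply/hasP; exists a => //.
    by rewrite /= !inE eqxx orbT.
  by apply/existsP; exists u; rewrite /= !inE eqxx ud.
suff /closed_connect/(_ _ _ (connG x y)) : closed (@adj G) S.
  by rewrite xS (negPf yS).
apply: intro_closed; first exact/sym_connect_sym/adj_sym.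
move=> u v uv uS; apply: contraNT noexit => vS.
by apply/existsP; exists u; apply/existsP; exists v; apply/and3P.
Qed.

Lemma ex_connected_seq (G : sgraph) (connG : connected_graph G) (n : nat) :
  n <= #|edge G| ->
  exists s : n.-tuple (edge G), uniq s && connected_seq s.
Proof.
elim: n => [_|n IHn ltn].
  by exists [tuple]; apply/forallP=> -[].
have [s /andP[us cs]] := IHn (ltnW ltn).
have [b bs] : exists b, b \notin s.
  apply/existsP; apply: contraTT ltn => /existsPn sall; rewrite -leqNgt.
  rewrite -(size_tuple s) -(card_uniqP us); apply/subset_leq_card/subsetP => a _.
  by have := sall a; rewrite negbK.
have [a [as_ ad]] : exists a, a \notin s /\
    (0 < n -> exists2 d, d \in s & share_endpoint a d).
  case: (posnP n) => [n0|n_gt0]; first by exists b; split; rewrite // n0.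
  have [a [d [as_ ds ad]]] := ex_next_edge connG bs (mem_tnth (Ordinal n_gt0) s).
  by exists a; split=> // _; exists d.
exists [tuple of rcons s a]; rewrite rcons_uniq as_ us /=.
apply/forallP=> i; apply/implyP=> i_gt0; rewrite (tnth_nth a) /= nth_rcons size_tuple.
have [lt_in|le_ni] := ltnP i n.
  have /existsP[j /andP[ltj sh]] := implyP (forallP cs (Ordinal lt_in)) i_gt0.
  apply/existsP; exists (widen_ord (leqnSn n) j); rewrite (tnth_nth a) /=.
  rewrite nth_rcons size_tuple ltn_ord ltj /=.
  by move: sh; rewrite !(tnth_nth a).
have iE : i = n :> nat by apply/eqP; rewrite eqn_leq le_ni andbT -ltnS.
rewrite iE eqxx; rewrite iE in i_gt0.
have [d /tnthP[j ->] sh] := ad i_gt0.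
apply/existsP; exists (widen_ord (leqnSn n) j); rewrite (tnth_nth a) /=.
by rewrite nth_rcons size_tuple ltn_ord -tnth_nth sh.
Qed.

Lemma ex_connected_greedy_colorable (G : sgraph) (connG : connected_graph G) :
  exists k, connected_greedy_colorable G k.
Proof.
have [s /andP[us cs]] := ex_connected_seq connG (leqnn _).
exists (greedy_num_colors s); apply/existsP; exists s; rewrite cs eqxx !andbT.
apply: uniq_perm => //; first exact: enum_uniq.
have sub : {subset s <= enum (edge G)} by move=> a _; rewrite mem_enum.
by apply: (uniq_min_size us sub _).2; rewrite !size_tuple.
Qed.

Definition connected_greedy_chromatic_index (G : sgraph)
    (connG : connected_graph G) : nat :=
  ex_minn (ex_connected_greedy_colorable connG).

(* Main.v *)
Require Import Defs.
From mathcomp Require Import all_boot.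

(** Let D be the maximum degree.  By induction on D, a bipartite graph with a
    root r has a D-edge-colouring that a greedy colouring can follow along a
    connected ordering of the component of r starting at r.  Remove a matching M
    covering all vertices of degree D; the components left over are coloured with
    D - 1 colours by induction, and the edges of M receive the last colour.  After
    a component is coloured, an edge of M leaving it at a vertex of degree D does
    receive the last colour, and gives access to the next component, which is
    then coloured from its entry vertex.  The point is to choose M such that
    every component can be entered in this way.  Take M for which the set R of
    vertices reached is largest.  If R is not everything, an edge of M leaves R
    at a vertex of smaller degree and ends at a vertex z of degree D.  By Konig's
    theorem the subgraph outside R has a matching that covers z and all its
    vertices of degree D; exchanging M for it outside R makes R larger. *)

Set Implicit Arguments.
Unset Strict Implicit.
Unset Printing Implicit Defensive.

(** * Degrees, colours at a vertex and linkage in edge sets *)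

Section EdgeSets.

Variable G : sgraph.
Implicit Types (F H M T : {set edge G}) (e f : edge G) (x y : G).
Implicit Types (c : edge G -> nat).

Definition degree F x := #|[set e in F | x \in val e]|.

Definition proper_on F c :=
  {in F &, forall e f, share_endpoint e f -> c e = c f -> e = f}.

Definition linked F : rel G :=
  [rel x y | [exists e in F, (x \in val e) && (y \in val e)]].

Lemma share_endpointI e f x : x \in val e -> x \in val f -> share_endpoint e f.
Proof. by move=> xe xf; apply/existsP; exists x; rewrite xe. Qed.

Lemma share_endpointC e f : share_endpoint e f = share_endpoint f e.
Proof. by apply: eq_existsb => x; rewrite andbC. Qed.

Lemma linkedI F e x y : e \in F -> x \in val e -> y \in val e -> linked F x y.
Proof. by move=> eF xe ye; apply/exists_inP; exists e; rewrite // xe. Qed.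

Lemma linked_connect_sym F : connect_sym (linked F).
Proof.
apply: sym_connect_sym => x y; apply: eq_existsb => e.
by rewrite [X in _ && X]andbC.
Qed.

Lemma degree_sub F H x : F \subset H -> degree F x <= degree H x.
Proof.
move=> /subsetP sFH; apply/subset_leq_card/subsetP=> e.
by rewrite !inE => /andP[/sFH-> ->].
Qed.

Lemma degree_gt0 F e x : e \in F -> x \in val e -> 0 < degree F x.
Proof. by move=> eF xe; apply/card_gt0P; exists e; rewrite inE eF. Qed.

Lemma degreeD1 F e x : e \in F -> x \in val e ->
  degree F x = (degree (F :\ e) x).+1.
Proof.
move=> eF xe; rewrite /degree (cardsD1 e) inE eF xe; congr _.+1.
by apply: eq_card => f; rewrite !inE andbA.
Qed.

(** Fewer than [D] edges of [F] contain [x], so they cannot use all the colours below [D]. *)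
Lemma free_colour F c x D : degree F x < D ->
  exists2 k, k < D & forall f, f \in F -> x \in val f -> c f != k.
Proof.
move=> ltD; pose s := [seq c f | f in [set f in F | x \in val f]].
have /allPn[k] : ~~ all [in s] (iota 0 D).
  apply: contraL ltD => /allP sub; rewrite -leqNgt.
  by have := uniq_leq_size (iota_uniq 0 D) sub; rewrite size_iota size_image.
rewrite mem_iota => /= ltk sk; exists k => // f fF xf.
by apply: contraNneq sk => <-; apply: image_f; rewrite inE fF.
Qed.

(** Properness makes the colours at [x] distinct, and [D] distinct colours below [D] are all of
    them. *)
Lemma saturated F c x D :
    proper_on F c -> {in F, forall e, c e < D} -> D <= degree F x ->
  forall k, k < D -> exists f, [/\ f \in F, x \in val f & c f = k].
Proof.
move=> cP cD leD k ltk; pose s := [seq c f | f in [set f in F | x \in val f]].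
have us : uniq s.
  apply/dinjectiveP => e f; rewrite !inE => /andP[eF xe] /andP[fF xf].
  by apply: cP => //; apply: share_endpointI xf.
have sub : {subset s <= iota 0 D}.
  by move=> _ /imageP[f /[!inE] /andP[fF _] ->]; rewrite mem_iota cD.
have [_ eqs] := uniq_min_size us sub (leq_trans (eq_leq (size_iota _ _))
  (leq_trans leD (eq_leq (esym (size_image _ _))))).
have : k \in s by rewrite eqs mem_iota.
by case/imageP=> f /[!inE] /andP[fF xf] ->; exists f.
Qed.

Lemma linked_connect_edge F x y :
  connect (linked F) x y -> x = y \/ exists2 e, e \in F & y \in val e.
Proof.
rewrite linked_connect_sym => /connectP[[|z p] /=]; first by left.
by case/andP=> /exists_inP[e eF /andP[ye _]] _ _; right; exists e.
Qed.

End EdgeSets.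

(** * Reachability from a root in a finite relation *)

(** A path from [r] only takes steps at vertices reachable from [r], so the relations are compared
    there alone. This serves to compare two matchings that agree only near the reached set. *)
Lemma connect_sub_from (V : finType) (e1 e2 : rel V) (r x : V) :
    (forall y z, connect e1 r y -> e1 y z -> e2 y z) ->
  connect e1 r x -> connect e2 r x.
Proof.
move=> sub /connectP[p]; elim/last_ind: p x => [|p z IHp] x /=; first by move=> _ ->.
rewrite rcons_path last_rcons => /andP[ep pz] ->.
apply: connect_trans (IHp _ ep erefl) (connect1 (sub _ _ _ pz)).
by apply/connectP; exists p.
Qed.

(** [d] is the distance from [r]: dropping the last step of a shortest path gives a predecessor of
    smaller rank. Unreachable vertices get 0, from a vacuous condition. *)
Lemma connect_rank (V : finType) (e : rel V) (r : V) :
  exists d : V -> nat, forall x, connect e r x ->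
    x = r \/ exists y, [/\ connect e r y, e y x & d y < d x].
Proof.
pose P x n := [exists p : n.-tuple V, path e r p && (last r p == x)].
have PI p : path e r p -> P (last r p) (size p).
  by move=> ep; apply/existsP; exists (in_tuple p); rewrite ep /=.
have exP x : exists n, connect e r x ==> P x n.
  case: (boolP (connect e r x)) => [/connectP[p ep ->]|]; last by exists 0.
  by exists (size p); apply: PI.
exists (fun x => ex_minn (exP x)) => x rx.
case: (ex_minnP (exP x)) => n; rewrite rx /= => /existsP[[p /= /eqP <-]] /andP[].
case/lastP: p => [_ /eqP|p z]; first by left.
rewrite rcons_path last_rcons size_rcons => /andP[ep epz] /eqP zx min_n.
right; exists (last r p); rewrite -zx epz.
have rp : connect e r (last r p) by apply/connectP; exists p.
split=> //; case: ex_minnP => m _; apply; rewrite rp; exact: PI.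
Qed.

(** * König's edge colouring theorem by Kempe chains *)

Section Bipartite.

Variables (G : sgraph) (A : {set G}).
Hypothesis bipA : forall x y : G, adj x y -> (x \in A) != (y \in A).
Implicit Types (F H M T : {set edge G}) (e f : edge G) (x y : G).
Implicit Types (c : edge G -> nat).

Lemma edge_side_inj e x y :
  x \in val e -> y \in val e -> (x \in A) = (y \in A) -> x = y.
Proof.
case: e => e /= /imset2P[u v _ /[!inE]/= /bipA uv ->].
by rewrite !inE => /orP[]/eqP-> /orP[]/eqP-> // E; move: uv; rewrite E eqxx.
Qed.

Lemma edge_side e b : exists2 x, x \in val e & (x \in A) = b.
Proof.
case: e => e /= /imset2P[u v _ /[!inE]/= /bipA uv ->].
have [ub|ub] := eqVneq (u \in A) b; first by exists u; rewrite ?inE ?eqxx.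
exists v; first by rewrite !inE eqxx orbT.
by move: uv ub; case: (u \in A) (v \in A) b => [] [] [].
Qed.

(** The edge [e] has exactly one end on side [b], and takes up one of the at most [D] places there
    itself. *)
Lemma edge_free_colour F c e D b :
    e \notin F -> (forall x, degree (e |: F) x <= D) ->
  exists2 k, k < D & forall x f,
    x \in val e -> (x \in A) = b -> f \in F -> x \in val f -> c f != k.
Proof.
move=> eF degD; have [x xe xb] := edge_side e b.
have : degree F x < D.
  by have := degD x; rewrite (degreeD1 (setU11 e F) xe) setU1K.
case/(free_colour c) => k ltk kP; exists k => // y f ye yb.
have -> : y = x by apply: edge_side_inj ye xe _; rewrite xb.
exact: kP.
Qed.

(* The directed walk leaves A through colour b and the other side through
   colour a; since a is missing at its start, the set it reaches is closed
   under both colours, and its vertices outside A all carry colour b. *)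
Lemma kempe_closed F c e a b :
    proper_on F c ->
    (forall x f, x \in val e -> x \in A -> f \in F -> x \in val f -> c f != a) ->
    (forall x f, x \in val e -> x \notin A -> f \in F -> x \in val f -> c f != b) ->
  exists Z : {set G}, [/\ forall x, x \in val e -> (x \in Z) = (x \in A)
    & forall f x y, f \in F -> c f = a \/ c f = b ->
        x \in val f -> y \in val f -> x \in Z -> y \in Z].
Proof.
move=> cP fa fb; have [x0 x0e x0A] := edge_side e true.
pose step := [rel x y : G | ((x \in A) != (y \in A)) &&
  [exists f in F, [&& x \in val f, y \in val f & c f == if x \in A then b else a]]].
have pred x : connect step x0 x -> x = x0 \/ exists2 y, connect step x0 y & step y x.
  case/connectP=> p; case/lastP: p => [|p z]; first by left.
  rewrite rcons_path last_rcons => /andP[sp st] ->; right.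
  by exists (last x0 p) => //; apply/connectP; exists p.
exists [set x | connect step x0 x]; split=> [x xe|f x y fF cf xf yf].
  rewrite inE; have [xA|xA] := boolP (x \in A).
    by rewrite (edge_side_inj xe x0e) ?connect0 // xA.
  apply/negP=> /pred[E|]; first by rewrite E x0A in xA.
  move=> [y _ /= /andP[yx /exists_inP[f fF /and3P[_ xf /eqP cf]]]].
  have yA : y \in A by move: yx; rewrite (negPf xA); case: (y \in A).
  by have := fb x f xe xA fF xf; rewrite cf yA eqxx.
rewrite !inE => Zx; have [E|ne] := eqVneq (x \in A) (y \in A).
  by rewrite -(edge_side_inj xf yf E).
have [out|] := eqVneq (c f) (if x \in A then b else a).
  apply: connect_trans Zx (connect1 _); rewrite /= ne /=.
  by apply/exists_inP; exists f; rewrite // xf yf out eqxx.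
(* Here [f] has the colour by which the walk enters [x]. At the start [x0] that colour is missing;
   elsewhere properness makes [f] the edge last walked, so [y] is the previous vertex. *)
move=> inn; have {}inn : c f = if x \in A then a else b.
  by move: inn; case: (x \in A) cf => [] [] ->; rewrite ?eqxx.
case: (pred _ Zx) => [E|[z Zz /= /andP[zx /exists_inP[g gF /and3P[zg xg /eqP cg]]]]].
  move: xf inn; rewrite E x0A => x0f cfa.
  by have := fa x0 f x0e x0A fF x0f; rewrite cfa eqxx.
suff -> : y = z by [].
have gf : g = f.
  apply: cP => //; first exact: share_endpointI xf.
  by rewrite cg inn; case: (x \in A) (z \in A) zx => [] [].
apply: (@edge_side_inj f); rewrite // -?gf //.
by move: ne zx; case: (x \in A) (y \in A) (z \in A) => [] [] [].
Qed.

(** Induction on the number of edges. With [e] removed, [a] is missing at its end in [A] and [b] at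
    the other end. Swapping [a] and [b] on the edges meeting a closed set [Z] that contains only the
    first end frees [b] at both ends. *)
Lemma konig F D : (forall x, degree F x <= D) ->
  exists2 c, {in F, forall e, c e < D} & proper_on F c.
Proof.
have [n] := ubnP #|F|; elim: n F => // n IHn F ltF degD.
have [->|[e eF]] := set_0Vmem F.
  by exists (fun=> 0) => [e|e f]; rewrite inE.
pose F0 := F :\ e; have eF0 : e \notin F0 by rewrite !inE eqxx.
have FE : e |: F0 = F by rewrite setD1K.
have [|x|c cD cP] := IHn F0.
- by move: ltF; rewrite (cardsD1 e) eF.
- exact: leq_trans (degree_sub _ (subD1set _ _)) (degD x).
have degF0 x : degree (e |: F0) x <= D by rewrite FE.
have [a ltaD fa] := edge_free_colour c true eF0 degF0.
have [b ltbD fb] := edge_free_colour c false eF0 degF0.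
have [|x f xe /negbTE|Z [Ze Zcl]] := kempe_closed (e := e) (a := a) (b := b) cP.
- exact: fa.
- exact: fb.
pose inZ f := [exists x, (x \in val f) && (x \in Z)].
pose sw k := if k == a then b else if k == b then a else k.
have swK : involutive sw.
  move=> k; rewrite /sw; case: (eqVneq k a) => [->|ka].
    by case: (eqVneq b a); rewrite ?eqxx // => ->.
  by case: (eqVneq k b) => [->|/negPf kb]; rewrite ?eqxx // (negPf ka) kb.
have swD k : k < D -> sw k < D by rewrite /sw; case: ifP => // _; case: ifP.
pose c1 f := if inZ f then sw (c f) else c f.
have c1D f : f \in F0 -> c1 f < D.
  by move=> /cD ltc; rewrite /c1; case: ifP => // _; apply: swD.
have c1P : proper_on F0 c1.
  move=> f g fF gF fg; rewrite /c1.
  (* If [h] had colour [a] or [b], closedness would put all its ends in [Z], and [k] would meet [Z].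
     So the swap fixes the colour of [h]. *)
  have swap_only h k : h \in F0 -> k \in F0 -> share_endpoint h k ->
      inZ h -> ~~ inZ k -> sw (c h) = c k -> h = k.
    move=> hF kF hk /existsP[x /andP[xh xZ]] /existsPn kZ.
    have [ab|] := boolP ((c h == a) || (c h == b)).
      have /existsP[y /andP[yh yk]] := hk; case/negP: (kZ y); rewrite yk.
      by apply: (Zcl h x y) => //; case/orP: ab => /eqP; [left|right].
    rewrite negb_or => /andP[/negPf na /negPf nb]; rewrite /sw na nb.
    exact: cP.
  case: (boolP (inZ f)) (boolP (inZ g)) => [fZ|fZ] [gZ|gZ].
  - by move/(inv_inj swK); apply: cP.
  - exact: swap_only.
  - by move=> E; apply/esym; apply: swap_only; rewrite // share_endpointC.
  - exact: cP.
(* At the end in [A] all edges are swapped and none had colour [a]. At the other end none had colour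
   [b], and an edge of colour [a] meeting [Z] would put that end in [Z]. *)
have c1e f : f \in F0 -> share_endpoint e f -> c1 f != b.
  move=> fF /existsP[x /andP[xe xf]]; rewrite /c1.
  have [xA|xA] := boolP (x \in A).
    have xZ : x \in Z by rewrite Ze.
    have -> : inZ f by apply/existsP; exists x; rewrite xf.
    have fna := fa _ _ xe xA fF xf.
    by rewrite -[b](_ : sw a = _) ?(inj_eq (inv_inj swK)) // /sw eqxx.
  have fnb := fb _ _ xe (negbTE xA) fF xf.
  case: ifP => // /existsP[y /andP[yf yZ]].
  rewrite /sw; case: (c f =P a) => [ca|_]; last by rewrite (negPf fnb); exact: fnb.
  have : x \in Z by apply: (Zcl f y x) => //; left.
  by rewrite Ze // (negPf xA).
exists (fun f => if f == e then b else c1 f) => [f fF|f g fF gF fg].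
  by case: eqP => // /eqP fe; apply: c1D; rewrite !inE fe.
case: (eqVneq f e) (eqVneq g e) => [fe|fe] [ge|ge].
- by rewrite fe ge.
- by move=> E; have := c1e g; rewrite -fe fg !inE ge gF E eqxx => /(_ isT isT).
- move=> E; have := c1e f; rewrite share_endpointC -ge fg !inE fe fF E eqxx.
  by move=> /(_ isT isT).
- by apply: c1P; rewrite // !inE ?fe ?ge.
Qed.

(** * Matchings covering the vertices of full degree *)

(* Intended for D bounding the degrees: the edges outside M are traversed both
   ways, those of M only from their endpoints of degree D. *)
Definition arc F D M : rel G :=
  [rel x y | [exists e in F,
    [&& x \in val e, y \in val e & (e \notin M) || (degree F x == D)]]].

(** For [D] the maximum degree, removing such a matching lowers it. The last clause gives every edge
    of [M] an end of full degree, where it can be forced to take the last colour. *)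
Definition peeling F D M :=
  [/\ M \subset F, {in M &, forall e f, share_endpoint e f -> e = f},
      forall x, degree F x = D -> exists2 e, e \in M & x \in val e
    & forall e, e \in M -> exists2 x, x \in val e & degree F x = D].

Lemma arcI F D M e x y : e \in F -> x \in val e -> y \in val e ->
  e \notin M \/ degree F x = D -> arc F D M x y.
Proof.
move=> eF xe ye eM; apply/exists_inP; exists e; rewrite // xe ye /=.
by case: eM => [->|->]; rewrite ?eqxx ?orbT.
Qed.

(** Any colour class of a colouring with [D] colours covers the vertices of degree [D]; class 0 is
    taken, without its edges that have no such end. *)
Lemma ex_peeling F D : 0 < D -> (forall x, degree F x <= D) ->
  exists M, peeling F D M.
Proof.
move=> D_gt0 degD; have [c cD cP] := konig degD.
exists [set e in F | (c e == 0) && [exists x in val e, degree F x == D]]; split.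
- by apply/subsetP=> e /[!inE] /andP[].
- move=> e f /[!inE] /and3P[eF /eqP ce _] /and3P[fF /eqP cf _] ef.
  by apply: cP; rewrite // ce.
- move=> x dx; have [|e [eF xe ce]] := saturated (x := x) cP cD _ D_gt0.
    by rewrite dx.
  exists e; rewrite // inE eF ce /=; apply/exists_inP; exists x; rewrite ?dx //.
- by move=> e /[!inE] /and3P[_ _ /exists_inP[x xe /eqP]]; exists x.
Qed.

(* If an edge of F leaves the set R reached from r, it lies in M, so M may be
   exchanged outside R for a colour class of the subgraph avoiding R, chosen so
   that the edge is released and R grows. *)
Lemma peeling_extend F D M r :
    (forall x, degree F x <= D) -> peeling F D M ->
    (forall x, connect (linked F) r x -> connect (arc F D M) r x) \/
    exists2 M1, peeling F D M1 &
      #|connect (arc F D M) r| < #|connect (arc F D M1) r|.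
Proof.
move=> degD [sMF Mmatch Mcov Mfull].
pose R := [set x | connect (arc F D M) r x].
have rR : r \in R by rewrite inE.
have Rarc x y : x \in R -> arc F D M x y -> y \in R.
  by rewrite !inE => rx xy; apply: connect_trans rx (connect1 xy).
have [/exists_inP[e eF /existsP[u /existsP[v /and4P[ue ve uR vR]]]]|noexit] :=
  boolP [exists e in F, exists u, exists v,
           [&& u \in val e, v \in val e, u \in R & v \notin R]]; last first.
  left=> x rx; suff : x \in R by rewrite inE.
  suff /closed_connect/(_ _ _ rx) <- : closed (linked F) R by [].
  apply: intro_closed; first exact: linked_connect_sym.
  move=> y z /exists_inP[e eF /andP[ye ze]] yR; apply: contraNT noexit => zR.
  apply/exists_inP; exists e => //; apply/existsP; exists y.
  by apply/existsP; exists z; apply/and4P.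
right.
(* Otherwise [f] would be an arc from its end in [R], and [R] would reach further. *)
have bdry f x y : f \in F -> x \in val f -> y \in val f -> x \in R ->
    y \notin R -> f \in M /\ degree F x != D.
  move=> fF xf yf xR yR; split.
    apply: contraNT yR => fM.
    by apply: Rarc xR (arcI fF xf yf _); left.
  apply: contraNN yR => /eqP xD.
  by apply: Rarc xR (arcI fF xf yf _); right.
have [eM ufull] := bdry _ _ _ eF ue ve uR vR.
have [z ze zfull] := Mfull _ eM.
have zR : z \notin R.
  by apply/negP=> zR; have [_] := bdry _ _ _ eF ze ve zR vR; rewrite zfull eqxx.
pose touch f := [exists x in val f, x \in R].
pose H := [set f in F | ~~ touch f].
(* Since [u] has positive degree below [D], [D] exceeds 1 and [z] has an edge other than [e].
   Touching [R] would put that edge in the matching [M], beside [e]. *)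
have [f fH zf] : exists2 f, f \in H & z \in val f.
  have ltD : 1 < D.
    by apply: leq_ltn_trans (degree_gt0 eF ue) _; rewrite ltn_neqAle ufull degD.
  have /card_gt0P[f] : 0 < degree (F :\ e) z.
    by rewrite -ltnS -(degreeD1 eF ze) zfull.
  rewrite !inE => /andP[/andP[fe fF] zf]; exists f; rewrite // inE fF /=.
  apply: contraNN fe => /exists_inP[x xf xR]; apply/eqP; apply: Mmatch => //.
    by have [] := bdry _ _ _ fF xf zf xR zR.
  exact: share_endpointI zf ze.
have [|c cD cP] := @konig H D.
  move=> x; apply: leq_trans (degree_sub _ _) (degD x).
  by apply/subsetP=> g /[!inE] /andP[].
(* The class of [f] covers [z] as well as the vertices of degree [D] in [H]. *)
pose N := [set g in H | c g == c f].
have fN : f \in N by rewrite inE fH eqxx.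
have NE g : (g \in N) = (g \in H) && (c g == c f) by rewrite inE.
have HE g : (g \in H) = (g \in F) && ~~ touch g by rewrite inE.
have NH g : g \in N -> g \in H by rewrite NE => /andP[].
have Nmatch : {in N &, forall g h, share_endpoint g h -> g = h}.
  move=> g h; rewrite !NE => /andP[gH /eqP cg] /andP[hH /eqP ch] gh.
  by apply: cP; rewrite // cg.
have NR g x : g \in N -> x \in val g -> x \notin R.
  move=> /NH /[!HE] /andP[_ tg] xg; apply: contraNN tg => xR.
  by apply/exists_inP; exists x.
have Ncov x : degree H x = D -> exists2 g, g \in N & x \in val g.
  move=> xD; have [|g [gH xg cg]] := saturated (x := x) cP cD _ (cD f fH).
    by rewrite xD.
  by exists g; rewrite // NE gH cg eqxx.
(* Outside [R] the class [N] takes over; edges of [M] touching [R] stay unless they meet [N]. Edges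
   without an end of full degree are discarded. *)
pose M1 := [set g in F | [exists x in val g, degree F x == D] &&
  ((g \in N) || [&& g \in M, touch g & [forall h in N, ~~ share_endpoint g h]])].
have M1E g : (g \in M1) = (g \in F) && ([exists x in val g, degree F x == D] &&
  ((g \in N) || [&& g \in M, touch g & [forall h in N, ~~ share_endpoint g h]])).
  by rewrite inE.
have M1touch g x : g \in M1 -> x \in val g -> x \in R -> g \in M.
  rewrite M1E => /and3P[_ _ /orP[gN|/and3P[]//]] xg.
  by rewrite (negPf (NR _ _ gN xg)).
have M1P : peeling F D M1.
  split.
  - by apply/subsetP=> g /[!M1E] /andP[].
  - move=> g h; rewrite !M1E => /and3P[_ _ gM] /and3P[_ _ hM] gh.
    case/orP: gM hM => [gN|/and3P[gM _ /forall_inP gN]]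
      /orP[hN|/and3P[hM _ /forall_inP hN]].
    + exact: Nmatch.
    + by case/negP: (hN _ gN); rewrite share_endpointC.
    + by case/negP: (gN _ hN).
    + exact: Mmatch.
  - move=> x xD; have [/existsP[g /andP[gN xg]]|/existsPn xN] :=
      boolP [exists g, (g \in N) && (x \in val g)].
      exists g; rewrite // M1E gN /=; have /[!HE]/andP[-> _] := NH _ gN.
      by rewrite andbT; apply/exists_inP; exists x; rewrite ?xD.
    have [g [gF xg tg gM]] :
        exists g, [/\ g \in F, x \in val g, touch g & g \in M].
      have [xR|xR] := boolP (x \in R).
        have [g gM xg] := Mcov _ xD; exists g; split=> //.
          exact: (subsetP sMF).
        by apply/exists_inP; exists x.
      (* If no edge at [x] touches [R], then [x] keeps degree [D] in [H] and is covered by [N]. *)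
      have [/existsP[g /and3P[gF xg tg]]|/existsPn noT] :=
        boolP [exists g, [&& g \in F, x \in val g & touch g]].
        exists g; split=> //; case/exists_inP: tg => y yg yR.
        by have [] := bdry _ _ _ gF yg xg yR xR.
      have xH : degree H x = D.
        rewrite -xD; apply: eq_card => g; rewrite !in_set -andbA andbCA.
        have := noT g; case: (g \in F) (x \in val g) => [] [] //=;
          by rewrite ?andbF ?andbT.
      by have [g gN xg] := Ncov _ xH; have := xN g; rewrite gN xg.
    exists g; rewrite // M1E gF gM tg /=; apply/andP; split.
      by apply/exists_inP; exists x; rewrite ?xD.
    (* If [g] met [h] at [y], both [x] and [y] would be outside [R], hence both the end of [g]
       opposite to [w]. Then [h] would cover [x]. *)
    apply/orP; right; apply/forall_inP=> h hN.
    apply/negP=> /existsP[y /andP[yg yh]].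
    have yR := NR _ _ hN yh; case/exists_inP: tg => w wg wR.
    have [xR|xR] := boolP (x \in R).
      by have [_] := bdry _ _ _ gF xg yg xR yR; rewrite xD eqxx.
    have side t : t \in val g -> t \notin R -> (t \in A) = (w \notin A).
      move=> tg tR; have [tw|] := eqVneq (t \in A) (w \in A).
        by case/negP: tR; rewrite (edge_side_inj tg wg tw).
      by case: (t \in A) (w \in A) => [] [].
    have xy : x = y by apply: (edge_side_inj xg yg); rewrite (side x xg xR) (side y yg yR).
    by have := xN h; rewrite hN xy yh.
  - by move=> g /[!M1E] /and3P[_ /exists_inP[x xg /eqP]]; exists x.
exists M1 => //.
(* An edge of [M1] with an end in [R] was already in [M], so every arc starting in [R] survives. *)
have sub : R \subset connect (arc F D M1) r.
  apply/subsetP=> x /[!inE] rx; suff : connect (arc F D M1) r x by [].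
  apply: connect_sub_from rx => y w ry.
  case/exists_inP=> g gF /and3P[yg wg gM]; apply: (arcI gF yg wg).
  case/orP: gM => [gM|/eqP]; [left|by right].
  apply: contraNN gM => gM1; apply: (M1touch _ y) => //; rewrite inE; exact: ry.
rewrite (eq_card (_ : connect (arc F D M) r =i R)); last first.
  by move=> x; rewrite [RHS]inE.
apply: proper_card; apply/properP; split=> //; exists z => //.
(* The edge [e] is released because it meets [f] at [z], so [z] is newly reached. *)
apply: connect_trans (subsetP sub _ uR) (connect1 (arcI eF ue ze _)); left.
rewrite M1E; apply/negP=> /and3P[_ _ /orP[eN|/and3P[_ _ /forall_inP/(_ _ fN)]]].
  by have := NR _ _ eN ue; rewrite uR.
by rewrite (share_endpointI ze zf).
Qed.

(** Each exchange enlarges the reached set, whose size is bounded by the number of vertices. *)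
Lemma ex_closed_peeling F D r : 0 < D -> (forall x, degree F x <= D) ->
  exists2 M, peeling F D M &
    forall x, connect (linked F) r x -> connect (arc F D M) r x.
Proof.
move=> D_gt0 degD; have [M0 M0P] := ex_peeling D_gt0 degD.
have [n] := ubnP (#|G| - #|connect (arc F D M0) r|).
elim: n M0 M0P => // n IHn M MP ltn.
have [|[M1 M1P lt1]] := peeling_extend r degD MP; first by exists M.
apply: (IHn M1) => //; rewrite -ltnS; apply: leq_trans ltn; rewrite ltnS.
by apply: ltn_sub2l => //; apply: leq_trans lt1 (max_card _).
Qed.

(** * Colourings that grow greedily from a root *)

(* Colours are numbered from 0 here, one below those of [greedy_coloring]; [T]
   is the set of edges already coloured. *)
Definition growable r c T e :=
  ((r \in val e) || [exists f in T, share_endpoint e f]) &&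
  [forall k : 'I_(c e), exists f in T, share_endpoint e f && (c f == k)].

Lemma growableP r c T e : reflect
  ((r \in val e \/ exists2 f, f \in T & share_endpoint e f) /\
   forall k, k < c e -> exists f, [/\ f \in T, share_endpoint e f & c f = k])
  (growable r c T e).
Proof.
apply: (iffP andP) => -[g1 g2]; split.
- by case/orP: g1 => [|/exists_inP]; [left|right].
- move=> k ltk; have /exists_inP[f fT /andP[ef /eqP fk]] := forallP g2 (Ordinal ltk).
  by exists f.
- by apply/orP; case: g1 => [|/exists_inP]; [left|right].
- apply/forallP=> k; have [f [fT ef fk]] := g2 _ (ltn_ord k).
  by apply/exists_inP; exists f; rewrite // ef fk /=.
Qed.

(* [growable] is monotone in [T], so a suitable ordering of the component of [r]
   exists as soon as no proper subset of its edges is stuck. *)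
Definition rooted_greedy F r c := forall T,
  (forall e, e \in F -> growable r c T e -> e \in T) ->
  forall e x, e \in F -> x \in val e -> connect (linked F) r x -> e \in T.

(** Lets a colouring assembled from pieces inherit the property on one component. As [T] may contain
    edges elsewhere, the hypothesis on [c1] is applied to the part [T0] of [T] in the component of
    [r]. *)
Lemma rooted_greedy_component F r c1 c2 T :
    rooted_greedy F r c1 ->
    (forall e x, e \in F -> x \in val e -> connect (linked F) r x -> c1 e = c2 e) ->
    (forall e, e \in F -> growable r c2 T e -> e \in T) ->
  forall e x, e \in F -> x \in val e -> connect (linked F) r x -> e \in T.
Proof.
move=> c1G eqc Tcl.
pose T0 := [set e in T | (e \in F) && [exists x in val e, connect (linked F) r x]].
have T0P e : e \in T0 ->
    [/\ e \in T, e \in F & forall x, x \in val e -> connect (linked F) r x].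
  rewrite inE => /and3P[eT eF /exists_inP[x xe rx]]; split=> // y ye.
  by apply: connect_trans rx (connect1 (linkedI eF xe ye)).
have {}c1G := c1G T0.
move=> e x eF xe rx; suff /T0P[] : e \in T0 by [].
apply: c1G (eF) (xe) (rx) => {}e {xe rx}eF /growableP[grow1 grow2].
have [y ye ry] : exists2 y, y \in val e & connect (linked F) r y.
  case: grow1 => [re|[f /T0P[_ fF fr] /existsP[y /andP[ye yf]]]].
    by exists r.
  by exists y => //; apply: fr.
rewrite inE eF /=; apply/andP; split; last by apply/exists_inP; exists y.
apply: Tcl => //; apply/growableP; split.
  by case: grow1 => [|[f /T0P[fT _ _] ef]]; [left|right; exists f].
move=> k; rewrite -(eqc e y) // => /grow2[f [/T0P[fT fF fr] ef fk]].
exists f; split=> //; have [w wf] := edge_vertex f.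
by rewrite -(eqc f w) // fr.
Qed.

(** Each component of [F :\: M] is coloured from its vertex of least rank. If that vertex is reached
    and is not [r], its predecessor has smaller rank and so lies in another component; the arc
    between them is an edge of [M] leaving a vertex of full degree. *)
Lemma ex_rooted_greedy D F r : (forall x, degree F x <= D) ->
  exists c, [/\ {in F, forall e, c e < D}, proper_on F c & rooted_greedy F r c].
Proof.
elim: D F r => [|D IHD] F r degD.
  have F0 e : e \in F -> False.
    move=> eF; have [x xe] := edge_vertex e.
    by have := leq_trans (degree_gt0 eF xe) (degD x).
  by exists (fun=> 0); split=> [e /F0|e f /F0|T _ e x /F0].
have [M [sMF Mmatch Mcov Mfull] Mreach] := ex_closed_peeling r (ltn0Sn D) degD.
pose F1 := F :\: M.
have F1E e : (e \in F1) = (e \notin M) && (e \in F) by rewrite inE.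
have F1F e : e \in F1 -> e \in F by rewrite F1E => /andP[].
have degF1 x : degree F1 x <= D.
  have [xD|xD] := eqVneq (degree F x) D.+1.
    have [e eM xe] := Mcov _ xD; have eF := subsetP sMF _ eM.
    rewrite -ltnS -xD (degreeD1 eF xe) ltnS; apply: degree_sub.
    apply/subsetP=> f; rewrite F1E !inE => /andP[fM ->]; rewrite andbT.
    by apply: contraNneq fM => ->.
  apply: leq_trans (degree_sub x (subsetDl F M)) _.
  by have := degD x; rewrite leq_eqVlt (negPf xD) ltnS.
(* A vertex of full degree loses only one edge to the matching, so it sees every colour below
   [D]. *)
have fullF1 x : degree F x = D.+1 -> D <= degree F1 x.
  move=> xD; have [e eM xe] := Mcov _ xD; have eF := subsetP sMF _ eM.
  rewrite -ltnS -xD (degreeD1 eF xe) ltnS; apply/subset_leq_card/subsetP=> f.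
  rewrite inE => /andP[/setD1P[fe fF] xf]; rewrite inE F1E fF xf !andbT.
  by apply: contraNN fe => fM; apply/eqP/Mmatch => //; apply: share_endpointI xf xe.
have /fin_all_exists[C CP] := fun s : G => IHD F1 s degF1.
have [d dP] := connect_rank (arc F D.+1 M) r.
have symF1 := linked_connect_sym F1.
(* Minimizing from the canonical [root] makes [base] constant on components. *)
pose base x := [arg min_(y < root (linked F1) x |
  connect (linked F1) (root (linked F1) x) y) d y].
have baseP x : connect (linked F1) x (base x) /\
    forall y, connect (linked F1) x y -> d (base x) <= d y.
  rewrite /base; case: arg_minnP => [|y ry ymin]; first exact: connect0.
  have xr := connect_root (linked F1) x; split; first exact: connect_trans xr ry.
  by move=> z xz; apply: ymin; rewrite (same_connect symF1 (y := x)) // symF1.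
have base_eq x y : connect (linked F1) x y -> base x = base y.
  by rewrite /base => /(rootP symF1) ->.
(* The default 0 never occurs, as edges have vertices, and either end of an edge outside [M] gives
   the same [base]. *)
pose c e := if e \in M then D else
  if [pick x in val e] is Some x then C (base x) e else 0.
have cM e : e \in M -> c e = D by rewrite /c => ->.
have cF1 e x : e \in F1 -> x \in val e -> c e = C (base x) e.
  move=> eF1 xe; have := eF1; rewrite F1E /c => /andP[/negPf-> _].
  case: pickP => [y /= ye|/(_ x)/=]; last by rewrite xe.
  by rewrite (@base_eq y x) //; apply/connect1/(linkedI eF1).
have cF1D e : e \in F1 -> c e < D.
  move=> eF1; have [x xe] := edge_vertex e; rewrite (cF1 _ x) //.
  by case: (CP (base x)) => + _ _; apply.
have cF1P : proper_on F1 c.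
  move=> e f eF1 fF1 ef; have /existsP[x /andP[xe xf]] := ef.
  by rewrite !(cF1 _ x) //; case: (CP (base x)) => _ + _; apply.
exists c; split.
- move=> e eF; have [eM|eM] := boolP (e \in M); first by rewrite cM.
  by apply/ltnW/cF1D; rewrite F1E eM.
- move=> e f eF fF ef.
  have [eM|eM] := boolP (e \in M); have [fM|fM] := boolP (f \in M).
  + by move=> _; apply: Mmatch.
  + by rewrite cM // => E; have := cF1D f; rewrite F1E fM fF -E ltnn => /(_ isT).
  + by rewrite (cM f) // => E; have := cF1D e; rewrite F1E eM eF E ltnn => /(_ isT).
  + by apply: cF1P => //; rewrite F1E ?eM ?fM.
move=> T Tcl.
pose touched x := x = r \/ exists2 f, f \in T & x \in val f.
(* The edges of [F1] at [y] show all colours below [D], so [e] may take colour [D] once they are in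
   [T]. *)
have growM e y : e \in M -> y \in val e -> degree F y = D.+1 -> touched y ->
    (forall f, f \in F1 -> y \in val f -> f \in T) -> e \in T.
  move=> eM ye yD yt yT; apply: Tcl; first exact: (subsetP sMF).
  apply/growableP; split; first case: yt => [<-|[f fT yf]]; first by left.
    by right; exists f => //; apply: share_endpointI yf.
  move=> k; rewrite cM // => ltk.
  have [f [fF1 yf fk]] := saturated cF1P cF1D (fullF1 y yD) ltk.
  by exists f; split=> //; [apply: yT|apply: share_endpointI yf].
have main x : connect (arc F D.+1 M) r x ->
    touched x /\ forall e, e \in F1 -> x \in val e -> e \in T.
  (* Components are entered in order of the rank of their base. *)
  have [n] := ubnP (d (base x)); elim: n x => // n IHn x ltn rx.
  have [xb bmin] := baseP x; set b := base x in ltn xb bmin.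
  have rb : connect (arc F D.+1 M) r b.
    apply: connect_trans rx _; apply: connect_sub xb => y z /exists_inP[e].
    rewrite F1E => /andP[eM eF] /andP[ye ze].
    by apply/connect1/(arcI eF ye ze); left.
  have bt : touched b.
    have [|[y [ry /exists_inP[e eF /and3P[ye be eM]] lty]]] := dP _ rb.
      by left.
    (* An edge outside [M] would put [y] in the component of [x], with rank below the minimum. *)
    have {}eM : e \in M /\ degree F y = D.+1.
      have [eM'|eM'] := boolP (e \in M); first by move: eM; rewrite eM' => /eqP.
      have /bmin : connect (linked F1) x y.
        apply: connect_trans xb (connect1 (linkedI _ be ye)).
        by rewrite F1E eM'.
      by rewrite leqNgt lty.
    case: eM => eM yD; have [||yt yT] := IHn y.
    - apply: leq_ltn_trans ((baseP y).2 _ (connect0 _ _)) _.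
      exact: leq_trans lty ltn.
    - exact: ry.
    by right; exists e => //; apply: growM yT.
  have compT e y : e \in F1 -> y \in val e -> connect (linked F1) b y -> e \in T.
    have [_ _ Cg] := CP b.
    apply: (rooted_greedy_component (c2 := c) Cg)
        => [{}e {}y eF1 ye byc|{}e eF1 /growableP[ge1 ge2]].
      rewrite (cF1 e y) // -(@base_eq x) //; exact: connect_trans xb byc.
    (* The base [b] is [r] or lies on an edge of [T], so growing from [b] is growing from [r]. *)
    apply: Tcl; first exact: F1F.
    apply/growableP; split=> //; case: ge1 => [be|]; last by right.
    case: bt => [<-|[f fT bf]]; first by left.
    by right; exists f => //; apply: share_endpointI bf.
  have bx : connect (linked F1) b x by rewrite symF1.
  split; last by move=> e eF1 xe; apply: compT bx.
  have [<- //|[e eF1 xe]] := linked_connect_edge bx.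
  by right; exists e => //; apply: compT bx.
move=> e x eF xe rx; have [eM|eM] := boolP (e \in M); last first.
  by have [_] := main _ (Mreach _ rx); apply=> //; rewrite F1E eM.
have [y ye yD] := Mfull _ eM.
have [yt yT] : touched y /\ forall e, e \in F1 -> y \in val e -> e \in T.
  by apply/main/Mreach/(connect_trans rx)/connect1/(linkedI eF).
exact: growM yT.
Qed.

End Bipartite.

(** * From growable colourings to connected greedy orderings, and the lower bounds *)

Section GreedySequences.

Variable G : sgraph.
Implicit Types (s : seq (edge G)) (e f : edge G).

Lemma connected_seq_rcons n (s : n.-tuple (edge G)) e :
    connected_seq s -> (0 < n -> exists2 f, f \in s & share_endpoint e f) ->
  connected_seq [tuple of rcons s e].
Proof.
move=> cs es; apply/forallP=> i; apply/implyP=> i_gt0.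
have widen (j : 'I_n) :
    tnth [tuple of rcons s e] (widen_ord (leqnSn n) j) = tnth s j.
  by rewrite !(tnth_nth e) /= nth_rcons size_tuple ltn_ord.
have [lt_in|le_ni] := ltnP i n.
  have /existsP[j /andP[ltj sh]] := implyP (forallP cs (Ordinal lt_in)) i_gt0.
  apply/existsP; exists (widen_ord (leqnSn n) j); rewrite ltj widen.
  by rewrite (_ : i = widen_ord (leqnSn n) (Ordinal lt_in)) ?widen //; apply: val_inj.
have iE : i = n :> nat by apply/eqP; rewrite eqn_leq le_ni andbT -ltnS.
have [|f /tnthP[j ->] sh] := es; first by rewrite -iE.
apply/existsP; exists (widen_ord (leqnSn n) j); rewrite widen /= iE ltn_ord /=.
by rewrite (tnth_nth e) /= nth_rcons size_tuple iE ltnn eqxx.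
Qed.

Lemma fresh_colorE (l : seq nat) k :
  k.+1 \notin l -> (forall j, j < k -> j.+1 \in l) -> fresh_color l = k.+1.
Proof.
move=> kl ltl; rewrite /fresh_color; case: ex_minnP => m /andP[m_gt0 ml] min_m.
apply/eqP; rewrite eqn_leq min_m ?kl //=; case: m m_gt0 ml {min_m} => // m _ ml.
by rewrite ltnS leqNgt; apply: contraNN ml; apply: ltl.
Qed.

Lemma fresh_colorP (l : seq nat) : fresh_color l \notin l.
Proof. by rewrite /fresh_color; case: ex_minnP => m /andP[]. Qed.

Lemma greedy_coloring_rcons s e :
  greedy_coloring (rcons s e) = greedy_step (greedy_coloring s) e.
Proof. by rewrite /greedy_coloring foldl_rcons. Qed.

(** The ordering is extended by a growable edge: its neighbours in [s] show all smaller colours, and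
    properness excludes its own. The successor accounts for greedy colours starting at 1. *)
Lemma ex_greedy_tuple (connG : connected_graph G) r (c : edge G -> nat) n :
    proper_on setT c -> rooted_greedy setT r c -> n <= #|edge G| ->
  exists s : n.-tuple (edge G), [/\ uniq s, connected_seq s
    & greedy_coloring s = [seq (e, (c e).+1) | e <- s]].
Proof.
move=> cP cG len.
(* The induction also records an edge at [r]: a growable edge containing [r] then meets an earlier
   one. *)
suff [s []] : exists s : n.-tuple (edge G), [/\ uniq s, connected_seq s,
    greedy_coloring s = [seq (e, (c e).+1) | e <- s]
    & 0 < n -> exists2 f, f \in s & r \in val f] by exists s.
elim: n len => [_|n IHn ltn].
  by exists [tuple]; split=> //; apply/forallP=> -[].
have [s [us cs gs rs]] := IHn (ltnW ltn).
have [e es /growableP[ge1 ge2]] : exists2 e, e \notin s & growable r c [set f in s] e.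
  have [e es] : exists e, e \notin s.
    apply/existsP; apply: contraTT ltn => /existsPn sall; rewrite -leqNgt.
    rewrite -(size_tuple s) -(card_uniqP us); apply/subset_leq_card/subsetP => a _.
    by have := sall a; rewrite negbK.
  (* If nothing outside [s] were growable, [cG] would put every edge in [s]. *)
  apply/exists_inP; apply: contraNT es => /exists_inPn stuck.
  have [x xe] := edge_vertex e.
  suff : e \in [set f in s] by rewrite inE.
  apply: (cG _ _ e x); rewrite ?inE //; last first.
    apply: connect_sub (connG r x) => u v uv; apply: connect1.
    have uvE : [set u; v] \in edges G by apply/imset2P; exists u v; rewrite ?inE.
    by apply: (@linkedI _ _ (Sub [set u; v] uvE)); rewrite /= ?inE ?eqxx ?orbT.
  by move=> f _ fg; rewrite inE; apply: contraLR fg => /stuck.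
pose l := [seq p.2 | p <- greedy_coloring s & share_endpoint e p.1].
have fresh : fresh_color l = (c e).+1.
  have memE k : (k.+1 \in l) =
      has (fun f => share_endpoint e f && (c f == k)) s.
    rewrite /l gs filter_map -map_comp; apply/mapP/hasP.
      case=> f /=; rewrite mem_filter => /andP[/= ef fs] [->].
      by exists f; rewrite ?ef /=.
    by case=> f fs /andP[ef /eqP <-]; exists f; rewrite // mem_filter /= ef.
  apply: fresh_colorE => [|k ltk].
    rewrite memE; apply/hasPn=> f fs; apply/negP=> /andP[ef /eqP cf].
    by move: es; rewrite (cP e f) ?inE ?fs.
  have [f [/[!inE] fs ef fk]] := ge2 _ ltk.
  by rewrite memE; apply/hasP; exists f; rewrite // ef fk eqxx.
exists [tuple of rcons s e]; split.
- by rewrite rcons_uniq es.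
- apply: connected_seq_rcons => // n_gt0.
  case: ge1 => [re|[f /[!inE]]]; last by exists f.
  by have [f fs rf] := rs n_gt0; exists f => //; apply: share_endpointI rf.
- by rewrite greedy_coloring_rcons map_rcons -gs /greedy_step -/l fresh.
move=> _; have [n0|n_gt0] := posnP n.
  exists e; first by rewrite mem_rcons mem_head.
  case: ge1 => // -[f /[!inE]].
  have /size0nil s0 : size s = 0 by rewrite size_tuple.
  by rewrite memtE s0.
by have [f fs rf] := rs n_gt0; exists f; rewrite // mem_rcons inE fs orbT.
Qed.

Lemma unzip1_greedy s : [seq p.1 | p <- greedy_coloring s] = s.
Proof.
elim/last_ind: s => // s e IHs.
by rewrite greedy_coloring_rcons map_rcons IHs.
Qed.

Lemma greedy_coloring_proper s p q :
    uniq s -> p \in greedy_coloring s -> q \in greedy_coloring s ->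
  share_endpoint p.1 q.1 -> p.2 = q.2 -> p.1 = q.1.
Proof.
elim/last_ind: s p q => // s e IHs p q; rewrite rcons_uniq => /andP[_ us].
have new p' : p' \in greedy_coloring s -> share_endpoint e p'.1 ->
    p'.2 != fresh_color [seq p.2 | p <- greedy_coloring s & share_endpoint e p.1].
  move=> ps ep; set l := (X in fresh_color X); apply: contraNN (fresh_colorP l) => /eqP <-.
  by apply: map_f; rewrite mem_filter ep.
rewrite greedy_coloring_rcons !mem_rcons !inE.
move=> /predU1P[->|ps] /predU1P[->|qs] //=.
- by move=> eq /esym/eqP; rewrite (negPf (new _ qs eq)).
- by rewrite share_endpointC => ep /eqP; rewrite (negPf (new _ ps ep)).
- exact: IHs.
Qed.

Lemma chromatic_index_le_greedy s :
  edge_ordering s -> chromatic_index G <= greedy_num_colors s.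
Proof.
move=> sE; rewrite /chromatic_index; case: ex_minnP => m _; apply.
have us : uniq s by rewrite (perm_uniq sE) enum_uniq.
pose cols := undup [seq p.2 | p <- greedy_coloring s].
have /fin_all_exists[col colP] : forall e, exists k, (e, k) \in greedy_coloring s.
  move=> e; have : e \in [seq p.1 | p <- greedy_coloring s].
    by rewrite unzip1_greedy (perm_mem sE) mem_enum.
  by case/mapP=> -[f k] fk /= ->; exists k.
have colK e : col e \in cols by rewrite mem_undup; apply: (map_f snd (colP e)).
have ltc e : index (col e) cols < size cols by rewrite index_mem.
(* Colours are renumbered by their position in [cols], since only the distinct ones are counted. *)
apply/existsP; exists [ffun e => Ordinal (ltc e)].
apply/forallP=> e; apply/forallP=> f.
apply/implyP=> /andP[nef ef]; rewrite !ffunE; apply: contraNneq nef => -[].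
move/(congr1 (nth 0 cols)); rewrite !nth_index ?colK // => E; apply/eqP.
exact: (greedy_coloring_proper us (colP e) (colP f) ef).
Qed.

Lemma degree_le_chromatic_index x : degree [set: edge G] x <= chromatic_index G.
Proof.
rewrite /chromatic_index; case: ex_minnP => m /existsP[c /forallP cP] _.
rewrite /degree -[leqRHS]card_ord -(@card_in_imset _ _ c).
  exact: max_card.
move=> e f /[!inE]/= xe xf cef; apply/eqP; apply: contraT => nef.
have := forallP (cP e) f; rewrite nef cef eqxx.
by rewrite (share_endpointI xe xf).
Qed.

End GreedySequences.

(** * Equality of the two indices *)

Theorem theorem2 (G : sgraph) (connG : connected_graph G) (bipG : bipartite G) :
  connected_greedy_chromatic_index connG = chromatic_index G.
Proof.
apply/eqP; rewrite eqn_leq; apply/andP; split; last first.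
  rewrite /connected_greedy_chromatic_index.
  case: ex_minnP => k /existsP[s /and3P[sE _ /eqP<-]] _.
  exact: chromatic_index_le_greedy.
suff [s [us cs le_s]] : exists s : #|edge G|.-tuple (edge G),
    [/\ uniq s, connected_seq s & greedy_num_colors s <= chromatic_index G].
  rewrite /connected_greedy_chromatic_index; case: ex_minnP => k _ mink.
  apply: leq_trans le_s; apply: mink; apply/existsP; exists s; rewrite cs eqxx !andbT.
  apply: uniq_perm => //; first exact: enum_uniq.
  have sub : {subset s <= enum (edge G)} by move=> e _; rewrite mem_enum.
  by apply: (uniq_min_size us sub _).2; rewrite !size_tuple.
have [A bipA] := bipG.
(* Without edges the graph may lack a vertex to serve as root; the empty ordering then uses no
   colour. *)
have [E0|/card_gt0P[e0 _]] := posnP #|edge G|.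
  have [s /andP[us cs]] := ex_connected_seq connG (leqnn #|edge G|).
  exists s; split=> //; suff -> : tval s = [::] by [].
  by apply: size0nil; rewrite size_tuple.
have [r _] := edge_vertex e0.
(* The chromatic index itself serves as the bound on the degrees, in place of the maximum degree. *)
have [c [cD cP cG]] := ex_rooted_greedy bipA r (@degree_le_chromatic_index G).
have [s [us cs gs]] := ex_greedy_tuple connG cP cG (leqnn _).
exists s; split=> //; rewrite /greedy_num_colors gs -map_comp.
rewrite -(size_iota 1 (chromatic_index G)); apply: uniq_leq_size; first exact: undup_uniq.
move=> k; rewrite mem_undup => /mapP[e _ ->] /=.
by rewrite mem_iota /= add1n ltnS cD.
Qed.
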